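(* Let $A,B^f,B^s\in\mathbb{R}^{n\times n}$ with $B^f$ invertible, let $c_x:\mathbb{R}^n\to\mathbb{R}$ be non-negative and convex, let $T,k\ge1$, and let $w_1,\dots,w_T\in\mathbb{R}^n$. Suppose $c_s(\cdot)$ and $c_f(\cdot)$ are both equal to the same norm $\|\cdot\|$ on $\mathbb{R}^n$, and suppose $B^f=B^s$. Then the single-timescale problem (P1) (defined in the context) is equivalent to the multi-timescale problem (P2) (defined in the context), in the sense that they have the same optimal value, that $(f^*,0)$ is an optimal pair of fast and slow control actions for (P2) whenever $f^*$ is an optimal control action for (P1), and that $f^*+s^*$ is an optimal control action for (P1) whenever $(f^*,s^* )$ is an optimal pair for (P2). Further, (P1) can be reformulated as $$\min_{y_1,\dots,y_T\in\mathbb{R}^n}\ \sum_{t=1}^T c_t(y_t)+\|(B^f)^{-1}(y_t-Ay_{t-1})\|,\qquad y_0=0,$$ where $c_t(y_t)=c_x(y_t+v_t)$ for some vectors $v_t\in\mathbb{R}^n$ (depending only on $A$ and $w_1,\dots,w_t$); that is, there is a bijective change of variables between the control sequences $f$ of (P1) and the sequences $y$ that preserves the objective value.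
   Context: Problem (P1): $$\min_{x,f}\ \sum_{t=1}^T c_x(x_t)+c_f(f_t)\quad\text{s.t. } x_t=Ax_{t-1}+B^ff_t+w_t\ (1\le t\le T),\quad x_0=0,$$ where $x_t\in\mathbb{R}^n$ is the state, $f_t\in\mathbb{R}^n$ is the control action and $w_t$ is the disturbance. Problem (P2): $$\min_{x,f,s}\ \sum_{t=1}^T c_x(x_t)+c_f(f_t)+c_s(s_t)\quad\text{s.t. } x_t=Ax_{t-1}+B^ff_t+B^ss_t+w_t\ (1\le t\le T),\quad x_0=0,$$ $$s_t=s_{t-1}\ \text{ for all } t\in\{1,\dots,T\}\text{ with } t\notin\{0,k,2k,\dots\},$$ where $s_t\in\mathbb{R}^n$ is the slow control action ($s_0$ being a free variable that does not enter the objective). *)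

(* Defs.v *)
From HB Require Import structures.
From mathcomp Require Import all_boot all_order all_algebra.
From mathcomp Require Import all_classical all_reals all_analysis.

Set Implicit Arguments.
Unset Strict Implicit.
Unset Printing Implicit Defensive.

Import Order.TTheory GRing.Theory Num.Theory.
Local Open Scope classical_set_scope.
Local Open Scope ring_scope.

(* 'cV[R]_n carries a canonical norm (the sup norm), so an arbitrary norm on
   R^n is a function satisfying the axioms. *)
Record is_norm (R : realType) (n : nat) (nrm : 'cV[R]_n -> R) : Prop := IsNorm {
  is_norm_triangle : forall x y, nrm (x + y) <= nrm x + nrm y;
  is_norm_scale : forall (a : R) x, nrm (a *: x) = `|a| * nrm x;
  is_norm_eq0 : forall x, nrm x = 0 -> x = 0
}.

Definition opt_value (R : realType) (Z : Type) (D : set Z) (J : Z -> R) : \bar R :=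
  ereal_inf [set (J z)%:E | z in D].

Definition is_minimizer (R : realType) (Z : Type) (D : set Z) (J : Z -> R) (z : Z)
  : Prop := D z /\ forall z', D z' -> J z <= J z'.

(* Sequences u_1, ..., u_T: u_{t+1} is stored at index t : 'I_T. *)
Definition seq_from1 (R : realType) (n T : nat) : Type := {ffun 'I_T -> 'cV[R]_n}.

(* Sequences u_0, u_1, ..., u_T: u_t is stored at index t : 'I_T.+1. *)
Definition seq_from0 (R : realType) (n T : nat) : Type := {ffun 'I_T.+1 -> 'cV[R]_n}.

(* The index t : 'I_T stands for the time t + 1: the positions of u_{t+1} and
   u_t in a sequence starting at u_0 are [now t] and [before t]. *)
Definition now (T : nat) (t : 'I_T) : 'I_T.+1 := lift ord0 t.
Definition before (T : nat) (t : 'I_T) : 'I_T.+1 := widen_ord (leqnSn T) t.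

Section Problems.
Variables (R : realType) (n T : nat).

Definition P1_feasible (A Bf : 'M[R]_n) (w : seq_from1 R n T) :=
  [set z : seq_from0 R n T * seq_from1 R n T | let: (x, f) := z in
     x ord0 = 0 /\
     forall t : 'I_T, x (now t) = A *m x (before t) + Bf *m f t + w t].

Definition P1_cost (cx cf : 'cV[R]_n -> R)
    (z : seq_from0 R n T * seq_from1 R n T) : R :=
  let: (x, f) := z in \sum_(t < T) (cx (x (now t)) + cf (f t)).

(* The slow action s starts at s_0, which only enters the hold constraint. *)
Definition P2_feasible (A Bf Bs : 'M[R]_n) (k : nat) (w : seq_from1 R n T) :=
  [set z : seq_from0 R n T * seq_from1 R n T * seq_from0 R n T |
     let: (x, f, s) := z in
     [/\ x ord0 = 0,
         forall t : 'I_T, x (now t) =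
           A *m x (before t) + Bf *m f t + Bs *m s (now t) + w t
       & forall t : 'I_T, ~~ (k %| now t)%N -> s (now t) = s (before t)]].

Definition P2_cost (cx cf cs : 'cV[R]_n -> R)
    (z : seq_from0 R n T * seq_from1 R n T * seq_from0 R n T) : R :=
  let: (x, f, s) := z in
  \sum_(t < T) (cx (x (now t)) + cf (f t) + cs (s (now t))).

Definition P1_optimal_control (A Bf : 'M[R]_n) (w : seq_from1 R n T)
    (cx cf : 'cV[R]_n -> R) (f : seq_from1 R n T) : Prop :=
  exists x, is_minimizer (P1_feasible A Bf w) (P1_cost cx cf) (x, f).

Definition P2_optimal_control (A Bf Bs : 'M[R]_n) (k : nat) (w : seq_from1 R n T)
    (cx cf cs : 'cV[R]_n -> R) (f : seq_from1 R n T) (s : seq_from0 R n T) : Prop :=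
  exists x,
    is_minimizer (P2_feasible A Bf Bs k w) (P2_cost cx cf cs) (x, f, s).

Definition reform_feasible : set (seq_from0 R n T) := [set y | y ord0 = 0].

Definition reform_cost (A Bf : 'M[R]_n) (c : 'I_T -> 'cV[R]_n -> R)
    (nrm : 'cV[R]_n -> R) (y : seq_from0 R n T) : R :=
  \sum_(t < T) (c t (y (now t)) +
                nrm (invmx Bf *m (y (now t) - A *m y (before t)))).

(* The list [:: w_1; ...; w_{t+1}], where t + 1 is the time indexed by t. *)
Definition history (w : seq_from1 R n T) (t : 'I_T) : seq 'cV[R]_n :=
  take t.+1 (codom w).

End Problems.

(* Main.v *)
Require Import Defs.
From HB Require Import structures.
From mathcomp Require Import all_boot all_order all_algebra.
From mathcomp Require Import all_classical all_reals all_analysis.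

Set Implicit Arguments.
Unset Strict Implicit.
Unset Printing Implicit Defensive.

Import Order.TTheory GRing.Theory Num.Theory.
Local Open Scope classical_set_scope.
Local Open Scope ring_scope.

(** Equivalence of the two problems. When both actions enter the dynamics
    through the same matrix, only their sum [f + s] acts on the state, so
    merging them into one fast action keeps the state trajectory; the triangle
    inequality says that merging does not increase the cost
    ([P2_to_P1_merge]). Conversely a fast action is paired with the zero slow
    action at no cost, because a norm vanishes at zero ([P1_to_P2_embed]).
    Each problem is thus at least as good as the other, which gives equal
    optimal values ([opt_value_le]) and the transfer of optimal controls in
    both directions ([minimizer_transfer]).

    Reformulation. The dynamics are linear with zero initial state, so the
    state is the superposition [x = y + v] of the response [y] to the control
    inputs [B f_t] and the response [v] to the disturbances ([state_split]).
    The latter is determined by [A] and by the disturbances up to the present.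
    A trajectory determines its inputs, since [B f_t = y_t - A y_(t-1)], and
    every [y] with [y_0 = 0] is the trajectory of the inputs read off in this
    way; as [B] is invertible, [f |-> y] is the desired change of variables
    ([control_response_bij]). *)

(** * Domination between optimization problems *)

Section Domination.
Context {R : realType} {Z Z' : Type}.

Definition dominates (D : set Z) (J : Z -> R) (D' : set Z') (J' : Z' -> R)
  : Prop :=
  forall z', D' z' -> exists2 z, D z & J z <= J' z'.

Lemma opt_value_le (D : set Z) (J : Z -> R) (D' : set Z') (J' : Z' -> R) :
  dominates D J D' J' -> (opt_value D J <= opt_value D' J')%E.
Proof.
move=> dom; apply: le_ereal_inf_tmp => _ [z' Dz' <-].
have [z Dz le_z] := dom z' Dz'; apply: ge_ereal_inf.
by exists (J z)%:E; [exists z | rewrite lee_fin].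
Qed.

(** The value [J z] is a lower bound for [J'], because [D'] offers nothing that
    [D] does not match; a point of [D'] that reaches this bound is optimal. *)
Lemma minimizer_transfer (D : set Z) (J : Z -> R) (D' : set Z') (J' : Z' -> R)
    z z' :
  dominates D J D' J' -> is_minimizer D J z ->
  D' z' -> J' z' <= J z -> is_minimizer D' J' z'.
Proof.
move=> dom [_ minz] Dz' le_z'; split=> // z'' /dom[z1 Dz1 le_z1].
exact: le_trans le_z' (le_trans (minz _ Dz1) le_z1).
Qed.

End Domination.

(** * Merging the fast and slow actions *)

Section Merge.
Context {R : realType} {n T : nat}.
Implicit Types (x s : seq_from0 R n T) (f w : seq_from1 R n T).
Implicit Types (A B : 'M[R]_n) (cx nrm : 'cV[R]_n -> R).

Lemma is_norm0 nrm : is_norm nrm -> nrm 0 = 0.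
Proof. by case=> _ nrmZ _; rewrite -(scale0r 0) nrmZ normr0 mul0r. Qed.

Definition merge f s : seq_from1 R n T := [ffun t => f t + s (now t)].

Lemma merge_feasible {A B k w x f s} :
  P2_feasible A B B k w (x, f, s) -> P1_feasible A B w (x, merge f s).
Proof.
by case=> x0 dyn _; split=> // t; rewrite dyn ffunE mulmxDr !addrA.
Qed.

Lemma merge_cost_le cx nrm x f s : is_norm nrm ->
  P1_cost cx nrm (x, merge f s) <= P2_cost cx nrm nrm (x, f, s).
Proof.
move=> nrmP; apply: ler_sum => t _.
by rewrite ffunE -addrA lerD2l is_norm_triangle.
Qed.

Lemma embed_feasible {A B} k {w x f} :
  P1_feasible A B w (x, f) -> P2_feasible A B B k w (x, f, [ffun=> 0]).
Proof.
case=> x0 dyn; split=> // t; first by rewrite dyn ffunE mulmx0 addr0.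
by rewrite !ffunE.
Qed.

Lemma embed_cost cx nrm x f : is_norm nrm ->
  P2_cost cx nrm nrm (x, f, [ffun=> 0]) = P1_cost cx nrm (x, f).
Proof.
by move=> nrmP; apply: eq_bigr => t _; rewrite ffunE is_norm0 ?addr0.
Qed.

(** The state only sees the total action, so it follows the same path once the
    two actions are merged, and the triangle inequality bounds the price of
    the sum by the sum of the prices. *)
Lemma P2_to_P1_merge A B k w cx nrm : is_norm nrm ->
  dominates (P1_feasible A B w) (P1_cost cx nrm)
            (P2_feasible A B B k w) (P2_cost cx nrm nrm).
Proof.
move=> nrmP [[x f] s] feas; exists (x, merge f s).
  exact: merge_feasible feas.
exact: merge_cost_le.
Qed.

(** The zero slow action is free and satisfies every hold constraint. *)
Lemma P1_to_P2_embed A B k w cx nrm : is_norm nrm ->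
  dominates (P2_feasible A B B k w) (P2_cost cx nrm nrm)
            (P1_feasible A B w) (P1_cost cx nrm).
Proof.
move=> nrmP [x f] feas; exists (x, f, [ffun=> 0]).
  exact: embed_feasible.
by rewrite embed_cost.
Qed.

End Merge.

(** * Responses of the linear system *)

Section Response.
Context {R : realType} {n : nat}.
Implicit Type A : 'M[R]_n.

(** The final state of the system driven from zero by a list of inputs. Reading
    the inputs from a list makes it a function of the input history alone. *)
Definition response A (us : seq 'cV[R]_n) : 'cV[R]_n :=
  foldl (fun z u => A *m z + u) 0 us.

Context {T : nat}.
Implicit Types (y : seq_from0 R n T) (u w : seq_from1 R n T).

Definition trajectory A u : seq_from0 R n T :=
  [ffun i : 'I_T.+1 => response A (take i (codom u))].

Lemma trajectory0 A u : trajectory A u ord0 = 0.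
Proof. by rewrite ffunE take0. Qed.

Lemma trajectory_now A u (t : 'I_T) :
  trajectory A u (now t) = response A (history u t).
Proof. by rewrite ffunE lift0. Qed.

Lemma historyE u (t : 'I_T) :
  history u t = rcons (take (before t) (codom u)) (u t).
Proof.
have sz : (t < size (codom u))%N by rewrite size_codom card_ord.
rewrite /history (take_nth 0) //; congr rcons.
by rewrite (nth_map t) ?size_enum_ord // nth_ord_enum.
Qed.

Lemma trajectory_step A u (t : 'I_T) :
  trajectory A u (now t) = A *m trajectory A u (before t) + u t.
Proof. by rewrite trajectory_now historyE /response foldl_rcons ffunE. Qed.

(** Uniqueness for the initial value problem: a sequence is recognized as a
    trajectory by checking the recursion, which is how both superposition and
    the surjectivity of the change of variables are obtained. *)
Lemma trajectoryP A u y : y ord0 = 0 ->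
  (forall t, y (now t) = A *m y (before t) + u t) -> y = trajectory A u.
Proof.
move=> y0 dyn; apply/ffunP => -[i lt_i].
elim: i lt_i => [|i IHi] lt_i.
  have -> : Ordinal lt_i = ord0 by apply: val_inj.
  by rewrite y0 trajectory0.
have lt_iT : (i < T)%N by [].
have -> : Ordinal lt_i = now (Ordinal lt_iT) by apply: val_inj.
by rewrite dyn trajectory_step /before /widen_ord IHi.
Qed.

Lemma trajectoryD A u w (i : 'I_T.+1) :
  trajectory A [ffun t => u t + w t] i = trajectory A u i + trajectory A w i.
Proof.
pose y : seq_from0 R n T := [ffun i => trajectory A u i + trajectory A w i].
rewrite -(@trajectoryP A _ y); first by rewrite ffunE.
  by rewrite ffunE !trajectory0 addr0.
move=> t; rewrite [y (now t)]ffunE [y (before t)]ffunE [RHS]addrC.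
by rewrite [in RHS]ffunE !trajectory_step mulmxDr addrACA addrC.
Qed.

End Response.

(** * Eliminating the disturbance *)

Section Reformulation.
Context {R : realType} {n T : nat}.
Implicit Types (x y : seq_from0 R n T) (f w : seq_from1 R n T).
Implicit Types (A B : 'M[R]_n).

Definition control_response A B f : seq_from0 R n T :=
  trajectory A [ffun t => B *m f t].

Lemma control_recovered A B f (t : 'I_T) : B \in unitmx ->
  invmx B *m (control_response A B f (now t) -
              A *m control_response A B f (before t)) = f t.
Proof. by move=> uB; rewrite trajectory_step addrC addKr ffunE mulKmx. Qed.

Lemma control_response_bij A B : B \in unitmx ->
  set_bij setT (@reform_feasible R n T) (control_response A B).
Proof.
move=> uB; split.
- by move=> f _; exact: trajectory0.
- move=> f g _ _ eq_fg; apply/ffunP => t.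
  by rewrite -(control_recovered A f t uB) eq_fg control_recovered.
move=> y y0; pose f : seq_from1 R n T :=
  [ffun t => invmx B *m (y (now t) - A *m y (before t))].
exists f => //; apply/esym/trajectoryP => // t.
by rewrite !ffunE mulKVmx // addrC subrK.
Qed.

(** Superposition: the state is the response to the controls, shifted by the
    response to the disturbances seen so far. *)
Lemma state_split A B w x f (t : 'I_T) : P1_feasible A B w (x, f) ->
  x (now t) = control_response A B f (now t) + response A (history w t).
Proof.
case=> x0 dyn; rewrite -trajectory_now -trajectoryD.
by congr (fun_of_fin _ _); apply: trajectoryP => // s; rewrite dyn !ffunE addrA.
Qed.

Lemma reform_costE A B w (cx nrm : 'cV[R]_n -> R) x f :
  B \in unitmx -> P1_feasible A B w (x, f) ->
  P1_cost cx nrm (x, f) =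
  reform_cost A B (fun t z => cx (z + response A (history w t))) nrm
    (control_response A B f).
Proof.
move=> uB feas; apply: eq_bigr => t _.
by rewrite (state_split t feas) control_recovered.
Qed.

End Reformulation.

Theorem proposition1 (R : realType) (n : nat) (A : 'M[R]_n) :
  exists v : seq 'cV[R]_n -> 'cV[R]_n,
  forall (Bf Bs : 'M[R]_n) (cx cf cs nrm : 'cV[R]_n -> R) (T k : nat)
    (w : seq_from1 R n T),
  Bf \in unitmx ->
  (forall x, 0 <= cx x) ->
  convex_function [set: convex_lmodType 'cV[R]_n] cx ->
  (1 <= T)%N -> (1 <= k)%N ->
  is_norm nrm -> cs = nrm -> cf = nrm ->
  Bf = Bs ->
  [/\ opt_value (P1_feasible A Bf w) (P1_cost cx cf) =
        opt_value (P2_feasible A Bf Bs k w) (P2_cost cx cf cs),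
      forall f : seq_from1 R n T,
        P1_optimal_control A Bf w cx cf f ->
        P2_optimal_control A Bf Bs k w cx cf cs f [ffun=> 0],
      forall (f : seq_from1 R n T) (s : seq_from0 R n T),
        P2_optimal_control A Bf Bs k w cx cf cs f s ->
        P1_optimal_control A Bf w cx cf [ffun t => f t + s (now t)]
    & exists phi : seq_from1 R n T -> seq_from0 R n T,
        set_bij setT (@reform_feasible R n T) phi /\
        forall (x : seq_from0 R n T) (f : seq_from1 R n T),
          P1_feasible A Bf w (x, f) ->
          P1_cost cx cf (x, f) =
          reform_cost A Bf (fun t y => cx (y + v (history w t))) nrm (phi f)].
Proof.
exists (response A) => Bf Bs cx cf cs nrm T k w uB _ _ _ _ nrmP -> -> <-.
have merge_dom := @P2_to_P1_merge R n T A Bf k w cx nrm nrmP.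
have embed_dom := @P1_to_P2_embed R n T A Bf k w cx nrm nrmP.
split.
- by apply/le_anti; rewrite !opt_value_le.
- move=> f [x min_xf]; exists x; apply: (minimizer_transfer merge_dom min_xf).
    exact: embed_feasible min_xf.1.
  by rewrite embed_cost.
- move=> f s [x min_xfs]; exists x.
  apply: (minimizer_transfer embed_dom min_xfs).
    exact: merge_feasible min_xfs.1.
  exact: merge_cost_le.
exists (control_response A Bf); split; first exact: control_response_bij.
by move=> x f; exact: reform_costE.
Qed.
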